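(* Let $N=\{1,\dots,n\}$ be a set of agents and let $k_a,k_p$ be positive integers with $n\ge k_p+1$. Suppose each agent $i\in N$ submits a set $P_i=\{p_{i,1},\dots,p_{i,m_i}\}$ of $m_i\ge 1$ papers (the sets $P_i$ pairwise disjoint), with $m_i\cdot k_p\le k_a$ for every $i\in N$, and let $P=\bigcup_{i\in N}P_i$. For each $i\in N$ and $\ell\in[m_i]$ let $\sigma_{i,\ell}$ be a strict ranking of $N\setminus\{i\}$. Then there exists a valid assignment $R:N\times P\to\{0,1\}$ with the following property: for every choice of preference extensions $(\succcurlyeq_{i,\ell})_{i\in N,\ell\in[m_i]}$ and $(\succcurlyeq_i)_{i\in N}$ of $\vec\sigma=(\sigma_{i,\ell})$ that satisfy order separability and consistency, $R$ is in the core.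
   Context: Notation: $[q]=\{1,\dots,q\}$. For an assignment $R$ (a function $N'\times P'\to\{0,1\}$, where $R(i,j)=1$ means agent $i$ reviews paper $j$), let $R^a_i=\{j\in P' : R(i,j)=1\}$ and $R^p_j=\{i\in N' : R(i,j)=1\}$. Validity: An assignment $R:N\times P\to\{0,1\}$ is valid if (i) $|R^a_i|\le k_a$ for all $i\in N$; (ii) $|R^p_j|=k_p$ for all $j\in P$; and (iii) $R(i,p_{i,\ell})=0$ for all $i\in N$ and $\ell\in[m_i]$ (no agent reviews her own paper). A restricted assignment is given by a subset $N'\subseteq N$, subsets $P'_i\subseteq P_i$ for $i\in N'$, $P'=\bigcup_{i\in N'}P'_i$, and a map $\hat R:N'\times P'\to\{0,1\}$. It is valid if (i) $|\hat R^a_i|\le k_a$ for all $i\in N'$; (ii) $|\hat R^p_j|=k_p$ for all $j\in P'$; and (iii) no agent in $N'$ reviews any of her own papers. Preference extensions: For each $i\in N$ and $\ell\in[m_i]$, $\succcurlyeq_{i,\ell}$ is a complete preorder on subsets of $N\setminus\{i\}$ (the sets of reviewers for paper $p_{i,\ell}$), with strict part $\succ_{i,\ell}$. For each $i\in N$, $\succcurlyeq_i$ is a complete preorder on assignments (both the full valid assignments and the valid restricted assignments whose agent set contains $i$), with strict part $\succ_i$. Write $\sigma_{i,\ell}(i')$ for the position of $i'$ in $\sigma_{i,\ell}$; a smaller position means the reviewer is more preferred. Order separability: for every $i,\ell$ and all pairwise disjoint $S_1,S_2,S_3\subseteq N\setminus\{i\}$ with $|S_1|=|S_2|>0$, if $\sigma_{i,\ell}(i')<\sigma_{i,\ell}(i'')$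 for all $i'\in S_1$ and $i''\in S_2$, then $S_1\cup S_3\succ_{i,\ell}S_2\cup S_3$. Consistency: for every valid assignment $R$, every valid restricted assignment $\hat R$ over $N'\subseteq N$ and $P'=\bigcup_{i\in N'}P'_i$, and every agent $i^*\in N'$: if $R^p_{p_{i^*,\ell}}\succcurlyeq_{i^*,\ell}\hat R^p_{p_{i^*,\ell}}$ for every $p_{i^*,\ell}\in P'_{i^*}$, then $R\succcurlyeq_{i^*}\hat R$. Core: A valid assignment $R$ is in the core if there do not exist a nonempty $N'\subseteq N$, subsets $P'_i\subseteq P_i$ for $i\in N'$, and a valid restricted assignment $\hat R$ over $N'$ and $P'=\bigcup_{i\in N'}P'_i$ such that $\hat R\succ_i R$ for every $i\in N'$. *)

(* Defs.v *)
From mathcomp Require Import all_boot.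
Set Implicit Arguments. Unset Strict Implicit. Unset Printing Implicit Defensive.

Section Peer.
Variables (n ka kp : nat) (P : finType) (owner : P -> 'I_n).

(* An (extended) restricted assignment: (N', P', Rhat).  P' is the union of the
   P'_i (P'_i = papers of P' owned by i); Rhat is extended by 0 outside N' x P'. *)
Definition asg := ({set 'I_n} * {set P} * {ffun 'I_n * P -> bool})%type.

Definition asg_agents (a : asg) : {set 'I_n} := a.1.1.
Definition asg_papers (a : asg) : {set P} := a.1.2.
Definition asg_map (a : asg) : {ffun 'I_n * P -> bool} := a.2.

Definition rev_load (a : asg) (i : 'I_n) : {set P} :=
  [set j in asg_papers a | asg_map a (i, j)].
Definition reviewers (a : asg) (j : P) : {set 'I_n} :=
  [set i in asg_agents a | asg_map a (i, j)].

Definition valid_restr (a : asg) : Prop :=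
  [/\ (forall i j, asg_map a (i, j) -> (i \in asg_agents a) && (j \in asg_papers a)),
      (forall j, j \in asg_papers a -> owner j \in asg_agents a),
      (forall i, i \in asg_agents a -> #|rev_load a i| <= ka),
      (forall j, j \in asg_papers a -> #|reviewers a j| = kp) &
      (forall i j, i \in asg_agents a -> j \in asg_papers a -> owner j = i ->
                   asg_map a (i, j) = false)].

Definition full (R : {ffun 'I_n * P -> bool}) : asg := (setT, setT, R).
Definition valid (R : {ffun 'I_n * P -> bool}) : Prop := valid_restr (full R).

Definition strict T (r : T -> T -> Prop) x y := r x y /\ ~ r y x.

Definition complete_preorder_on T (D : T -> Prop) (r : T -> T -> Prop) :=
  (forall x y, D x -> D y -> r x y \/ r y x) /\
  (forall x y z, D x -> D y -> D z -> r x y -> r y z -> r x z).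

(* pe p : preference of owner p over reviewer sets (subsets of N \ {owner p}) *)
Definition paper_ext (pe : P -> {set 'I_n} -> {set 'I_n} -> Prop) :=
  forall p, complete_preorder_on (fun S : {set 'I_n} => S \subset ~: [set owner p]) (pe p).

Definition agent_dom (i : 'I_n) (a : asg) : Prop :=
  (exists R, valid R /\ a = full R) \/ (valid_restr a /\ i \in asg_agents a).

Definition agent_ext (ae : 'I_n -> asg -> asg -> Prop) :=
  forall i, complete_preorder_on (agent_dom i) (ae i).

(* sigma p j = position of j in the ranking for paper p (smaller = better) *)
Definition order_separable (sigma : P -> 'I_n -> nat)
    (pe : P -> {set 'I_n} -> {set 'I_n} -> Prop) :=
  forall p (S1 S2 S3 : {set 'I_n}),
    S1 \subset ~: [set owner p] -> S2 \subset ~: [set owner p] ->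
    S3 \subset ~: [set owner p] ->
    [disjoint S1 & S2] -> [disjoint S1 & S3] -> [disjoint S2 & S3] ->
    #|S1| = #|S2| -> 0 < #|S1| ->
    (forall i' i'', i' \in S1 -> i'' \in S2 -> sigma p i' < sigma p i'') ->
    strict (pe p) (S1 :|: S3) (S2 :|: S3).

Definition consistent (pe : P -> {set 'I_n} -> {set 'I_n} -> Prop)
    (ae : 'I_n -> asg -> asg -> Prop) :=
  forall R (a : asg) (istar : 'I_n),
    valid R -> valid_restr a -> istar \in asg_agents a ->
    (forall p, p \in asg_papers a -> owner p = istar ->
        pe p (reviewers (full R) p) (reviewers a p)) ->
    ae istar (full R) a.

Definition in_core (ae : 'I_n -> asg -> asg -> Prop) (R : {ffun 'I_n * P -> bool}) :=
  valid R /\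
  ~ (exists a : asg, asg_agents a != set0 /\ valid_restr a /\
       forall i, i \in asg_agents a -> strict (ae i) a (full R)).

End Peer.

(* Main.v *)
Require Import Defs.
From mathcomp Require Import all_boot zify.
Set Implicit Arguments. Unset Strict Implicit. Unset Printing Implicit Defensive.

(** Run top trading cycles: every agent with an incompletely reviewed paper
    requests, for one such paper, its best reviewer among the agents still in
    the market, and all agents on a cycle are served, so that each agent
    reviews exactly as much as her papers are reviewed. This never gets stuck
    while more than [kp] agents remain. Stop when at most [kp] remain, and let
    [W] be [kp + 1] agents present at the last step, including all remaining
    ones and some [l] that has just left.

    The gaps are filled by augmenting paths that leave the papers of agents
    outside [W] untouched and, on the papers of [l], only trade reviewers
    outside [W] for reviewers in [W]. If no augmentation is possible, the
    agents reachable from those with spare capacity form a set of size at most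
    [kp], and a double count shows that all papers are complete.

    A coalition not contained in [W] has a member outside [W] whose reviewers
    are the best available within the coalition. A coalition contained in [W]
    must be [W] itself, as it needs [kp + 1] agents; each paper of [l] is then
    reviewed by all of [W :\ l] in the deviation, which [l] cannot strictly
    prefer to what she has. *)

Section Augmentation.
Variables (I P : finType) (L H : P -> {set I}).
Implicit Types (R : P -> {set I}) (i s t y : I) (p j : P).

Definition load R i := #|[set p | i \in R p]|.

Definition between R := forall p, (L p \subset R p) && (R p \subset H p).

Definition exchange R : rel I :=
  fun t y => [exists p, (t \in H p :\: R p) && (y \in R p :\: L p)].

Lemma loadE R i : load R i = \sum_p (i \in R p).
Proof. by rewrite /load -sum1dep_card big_mkcond; apply: eq_bigr => p _; case: ifP. Qed.

Lemma sum_load R : \sum_i load R i = \sum_p #|R p|.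
Proof.
under eq_bigr do rewrite loadE; rewrite exchange_big; apply: eq_bigr => p _.
by rewrite -sum1_card [RHS]big_mkcond; apply: eq_bigr => i _; case: ifP.
Qed.

Lemma load_update R j (A : {set I}) i :
  load (fun q => if q == j then A else R q) i + (i \in R j)
    = load R i + (i \in A).
Proof.
rewrite !loadE [in LHS](bigD1 j) //= [in RHS](bigD1 j) //= eqxx.
under eq_bigr => q /negPf-> do []; lia.
Qed.

Lemma load_exchange R p s t i : s \notin R p -> t \in R p ->
  load (fun q => if q == p then s |: (R p :\ t) else R q) i + (i == t)
    = load R i + (i == s).
Proof.
move=> sR tR; have := load_update R p (s |: (R p :\ t)) i; rewrite !inE.
case: (eqVneq i s) => [->|_]; case: (eqVneq _ t) => [e|_] /=.
- by rewrite e tR in sR.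
- by rewrite (negPf sR) addn0.
- by rewrite e tR addn0.
- by move/addIn ->.
Qed.

Lemma path_sub_mem (e e' : rel I) s ts :
  (forall t y, t \in s :: ts -> y \in ts -> e t y -> e' t y) ->
  path e s ts -> path e' s ts.
Proof.
move=> sub_e /(pathP s) e_ts; apply/(pathP s) => k lt_k.
by apply: sub_e (e_ts k lt_k); apply: mem_nth => //=; apply: leqW.
Qed.

Lemma augment_path R s ts j :
  between R -> path (exchange R) s ts -> uniq (s :: ts) ->
  last s ts \in H j :\: R j ->
  exists R', [/\ between R', forall p, #|R' p| = #|R p| + (p == j) &
                 forall i, load R' i = load R i + (i == s)].
Proof.
elim: ts R s => [|t ts IH] R s bR /=.
  move=> _ _; rewrite inE => /andP[sR sH].
  exists (fun q => if q == j then s |: R j else R q); split=> [p|p|i].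
  - case: eqP => [->|_]; last exact: bR.
    have /andP[LR RH] := bR j.
    by rewrite (subset_trans LR (subsetUr _ _)) subUset sub1set sH.
  - by case: eqP => [->|_]; rewrite ?cardsU1 ?sR; lia.
  - have := load_update R j (s |: R j) i; rewrite !inE.
    by case: eqP => [->|_] /=; rewrite ?(negPf sR); lia.
case/andP=> /existsP[p /andP[]]; rewrite !inE => /andP[sR sH] /andP[tL tR] path_t.
case/andP=> /norP[st s_ts] /andP[t_ts u_ts] lastP.
pose R1 q := if q == p then s |: (R p :\ t) else R q.
have R1E x q : x != s -> x != t -> (x \in R1 q) = (x \in R q).
  by move=> xs xt; rewrite /R1; case: eqP => // ->; rewrite !inE (negPf xs) xt.
have neq_s x : x \in t :: ts -> x != s.
  rewrite inE => x_in; apply/eqP => xs; move: x_in.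
  by rewrite xs (negPf st) (negPf s_ts).
have neq_t x : x \in ts -> x != t by move=> x_in; apply/eqP => xt; rewrite -xt x_in in t_ts.
have load1 i : load R1 i + (i == t) = load R i + (i == s) := load_exchange i sR tR.
have card1 q : #|R1 q| = #|R q|.
  rewrite /R1; case: eqP => // ->; rewrite cardsU1 !inE (negPf sR) andbF.
  by rewrite (cardsD1 t (R p)) tR.
have b1 : between R1.
  move=> q; rewrite /R1; case: eqP => [->|_]; last exact: bR.
  have /andP[LR RH] := bR p; rewrite subUset sub1set sH /=; apply/andP; split.
    by rewrite (subset_trans _ (subsetUr _ _)) // subsetD1 LR.
  by rewrite (subset_trans (subsetDl _ _)).
have tR1 q : t \in R1 q -> t \in R q.
  by rewrite /R1; case: eqP => // _; rewrite !inE eqxx eq_sym (negPf st).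
have p1 : path (exchange R1) t ts.
  apply: path_sub_mem path_t => x y x_in y_in /existsP[q].
  rewrite !inE => /andP[/andP[xR xH] /andP[yL yR]].
  apply/existsP; exists q; rewrite !inE xH yL andbT /=.
  have ys : y != s by rewrite neq_s // inE y_in orbT.
  rewrite (R1E y) ?neq_t // yR andbT.
  case: (eqVneq x t) => [xt|xt]; last by rewrite R1E ?neq_s.
  by rewrite xt in xR *; apply: contra xR; exact: tR1.
have [||R' [bR' cR' lR']] := IH _ _ b1 p1; first by rewrite /= t_ts.
  move: lastP; rewrite !inE => /andP[lR ->]; rewrite andbT.
  case: (eqVneq (last t ts) t) lR => [->|lt lR]; first exact/contra/tR1.
  by rewrite R1E // neq_s // mem_last.
exists R'; split=> [//|q|i]; first by rewrite cR' card1.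
by rewrite lR' load1.
Qed.

(* [T] is the set of agents reachable from those with spare capacity. *)
Lemma augment_to_cut (k A : nat) R :
  between R -> (forall p, #|R p| <= k) -> (forall i, load R i <= A) ->
  exists R' (T : {set I}),
    [/\ between R', forall p, #|R p| <= #|R' p| <= k
      & forall i, load R i <= load R' i <= A] /\
    [/\ forall i, i \notin T -> load R' i = A,
        forall t p y, t \in T -> t \in H p :\: R' p -> y \in R' p :\: L p -> y \in T
      & forall j t, #|R' j| < k -> t \in T -> t \in H j -> t \in R' j].
Proof.
have [N] := ubnP (\sum_p (k - #|R p|)); elim: N R => // N IH R leN bR cR lR.
pose T := [set t | [exists s, (load R s < A) && connect (exchange R) s t]].
case: (boolP [exists j, (#|R j| < k) && [exists t in T, t \in H j :\: R j]]).
  case/existsP=> j /andP[ltj /exists_inP[t]]; rewrite inE.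
  case/existsP=> s /andP[spare /connectP[ts path_ts ->]] lastj.
  case/shortenP: path_ts lastj => ts' path_ts' u_ts' _ lastj.
  have [R1 [b1 c1 l1]] := augment_path bR path_ts' u_ts' lastj.
  case: (IH R1) => //.
  - rewrite ltnS in leN; apply: leq_trans leN.
    rewrite (bigD1 j) //= [X in _ <= X](bigD1 j) //= c1 eqxx.
    rewrite (eq_bigr (fun p => k - #|R p|)); first by lia.
    by move=> p /negPf pj; rewrite c1 pj addn0.
  - by move=> p; rewrite c1; have := cR p; case: eqP => [->|_]; lia.
  - by move=> i; rewrite l1; have := lR i; case: eqP => [->|_]; lia.
  move=> R' [T' [[b' c' l'] cut]]; exists R', T'; split=> //; split=> // [p|i].
    by have := c' p; rewrite c1; lia.
  by have := l' i; rewrite l1; lia.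
move/existsPn=> stuck; exists R, T; split; split=> //.
- by move=> p; rewrite leqnn cR.
- by move=> i; rewrite leqnn lR.
- move=> i; rewrite inE => /existsPn/(_ i); rewrite connect0 andbT -leqNgt => leA.
  by apply/eqP; rewrite eqn_leq lR.
- move=> t p y; rewrite inE => /existsP[s /andP[spare st]] tp yp; rewrite inE.
  apply/existsP; exists s; rewrite spare (connect_trans st) // connect1 //.
  by apply/existsP; exists p; rewrite tp.
- move=> j t ltj tT tH; have := stuck j; rewrite ltj /= => /exists_inPn/(_ t tT).
  by rewrite inE tH andbT negbK.
Qed.

End Augmentation.

Section Filling.
Variables (I P : finType) (owner : P -> I) (k A : nat).
Implicit Types (R : P -> {set I}) (S T V W : {set I}) (i t l : I) (p j : P).

Definition papers S := [set p | owner p \in S].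

Lemma card_papers S : #|papers S| = \sum_(i in S) #|papers [set i]|.
Proof.
rewrite -sum1_card (partition_big owner (mem S)) /=; last by move=> p; rewrite inE.
apply: eq_bigr => i iS; rewrite -sum1_card; apply: eq_bigl => p; rewrite !inE.
by case: eqP => [->|_]; rewrite ?iS ?andbF.
Qed.

Lemma card_papersU S T : [disjoint S & T] ->
  #|papers (S :|: T)| = #|papers S| + #|papers T|.
Proof.
move=> dST; rewrite !card_papers -bigU //.
by apply: eq_bigl => i; rewrite !inE.
Qed.

Hypothesis k_gt0 : 0 < k.
Hypothesis papers_le : forall i, #|papers [set i]| * k <= A.

Lemma card_papers_le S : #|papers S| * k <= #|S| * A.
Proof. by rewrite card_papers big_distrl -sum_nat_const; apply: leq_sum => i _. Qed.

Lemma sum_reviewers_inter R T S :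
  \sum_(p in papers S) #|R p :&: T| = \sum_(t in T) #|[set p in papers S | t \in R p]|.
Proof.
transitivity (\sum_(p in papers S) \sum_(t in T) (t \in R p)).
  apply: eq_bigr => p _; rewrite -sum1_card big_mkcond [RHS]big_mkcond /=.
  by apply: eq_bigr => t _; rewrite inE; case: (t \in R p); case: (t \in T).
rewrite exchange_big; apply: eq_bigr => t _.
rewrite -sum1_card big_mkcond [RHS]big_mkcond /=.
by apply: eq_bigr => p _; rewrite !inE; case: (owner p \in S); case: (t \in R p).
Qed.

(* Trade the load of [W = l |: V] for that of [T]: each agent of [W :\: T]
   contributes exactly [A], each agent of [T :\: W] at most [A], and each agent
   of [T] reviews every paper of [V] but her own. *)
Lemma cut_load V l T R :
  #|V| = k -> l \notin V -> #|T| <= k ->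
  (forall i, load R i <= A) -> (forall i, i \notin T -> load R i = A) ->
  (forall p t, owner p \in V -> t \in T -> t != owner p -> t \in R p) ->
  (forall p, owner p = l -> k <= #|R p :&: T| + #|V :\: T|) ->
  k * #|papers (l |: V)| <= \sum_(i in l |: V) load R i.
Proof.
move=> cV lV cT leA fullA TV Tl.
set W := l |: V; set M := #|papers V|; set m := #|papers [set l]|.
have MA : M <= A.
  by rewrite -(leq_pmul2r k_gt0); have := card_papers_le V; rewrite cV mulnC [A * k]mulnC.
have cMm : #|papers W| = M + m.
  by rewrite card_papersU 1?addnC // disjoints1.
pose g t := #|[set p in papers [set l] | t \in R p]|.
have gsum : k * m <= \sum_(t in T) g t + m * #|V :\: T|.
  rewrite -sum_reviewers_inter -sum_nat_const mulnC -sum_nat_const -big_split.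
  by apply: leq_sum => p; rewrite !inE => /eqP/Tl.
have loadT t : t \in T -> M + g t <= load R t + (t \in V) * #|papers [set t]|.
  move=> tT; rewrite /M /g -cardsUI disjoint_setI0 ?cards0 ?addn0; last first.
    rewrite -setI_eq0; apply/eqP/setP => p; rewrite !inE.
    by case: eqP => [->|_]; rewrite ?(negPf lV) ?andbF.
  have [tV|tV] := boolP (t \in V).
    rewrite mul1n -cardsUI; apply: leq_trans (leq_addr _ _); apply: subset_leq_card.
    apply/subsetP => p; rewrite !inE => /orP[pV|/andP[_ ->]//].
    by case: (eqVneq (owner p) t) => [|tp]; rewrite ?orbT // TV // eq_sym.
  rewrite addn0; apply: subset_leq_card; apply/subsetP => p.
  rewrite !inE => /orP[pV|/andP[_ ->]//]; apply: TV => //.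
  by apply: contraNneq tV => ->.
have sumT : \sum_(t in T) load R t + #|papers (V :&: T)| >= #|T| * M + \sum_(t in T) g t.
  rewrite -sum_nat_const -big_split /= card_papers.
  rewrite [X in _ <= _ + X](_ : _ = \sum_(t in T) (t \in V) * #|papers [set t]|).
    by rewrite -big_split; apply: leq_sum.
  rewrite big_mkcond [RHS]big_mkcond; apply: eq_bigr => t _; rewrite inE.
  by case: (t \in V); case: (t \in T); rewrite ?mul1n.
have loadD : \sum_(i in W :\: T) load R i = #|W :\: T| * A.
  by rewrite -sum_nat_const; apply: eq_bigr => i; rewrite inE => /andP[/fullA].
have loadQ : \sum_(i in T :\: W) load R i <= #|T :\: W| * A.
  by rewrite -sum_nat_const; apply: leq_sum.
have split1 : \sum_(i in W) load R i + \sum_(i in T :\: W) load R i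
    = \sum_(i in T) load R i + \sum_(i in W :\: T) load R i.
  rewrite (big_setID T) /= [X in _ = X + _](big_setID W) /= setIC; lia.
have cWT : #|W :\: T| + #|T| = #|T :\: W| + k.+1.
  have cW : #|W| = k.+1 by rewrite cardsU1 lV cV.
  by rewrite -cW -(cardsID W T) -[#|W|](cardsID T W) setIC; lia.
have capA : #|papers (V :&: T)| + m * #|V :\: T| <= A.
  have AE : A * k = #|V :&: T| * A + #|V :\: T| * A by rewrite -mulnDl cardsID cV mulnC.
  rewrite -(leq_pmul2r k_gt0) AE mulnDl.
  apply: leq_add; first exact: card_papers_le.
  by rewrite mulnAC mulnC leq_mul2l papers_le orbT.
rewrite cMm mulnDr.
move: MA gsum sumT loadD loadQ split1 cWT capA cT; clear.
move: (\sum_(t in T) g t) (\sum_(t in T) load R t) (\sum_(t in W) load R t) => G LT LW.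
move: (\sum_(t in W :\: T) load R t) (\sum_(t in T :\: W) load R t) => LD LQ.
move: #|papers (V :&: T)| (m * #|V :\: T|) (k * m) #|W :\: T| #|T :\: W| #|T|.
move: M => M MVT mv km a b t MA h1 h2 h3 h4 h5 h6 h7 h8; subst LD.
have [d kE] : exists d, k = t + d by exists (k - t); lia.
have aE : a = b + d.+1 by lia.
subst a; subst k; have dM := leq_mul (leqnn d) MA; rewrite !mulnDl mulSn in h5 *.
lia.
Qed.

Lemma fill_gaps W l R0 :
  #|W| = k.+1 -> l \in W ->
  (forall p, owner p \notin R0 p) -> (forall p, #|R0 p| <= k) ->
  (forall p, owner p \notin W :\ l -> #|R0 p| = k) ->
  (forall i, load R0 i = \sum_(p in papers [set i]) #|R0 p|) ->
  exists R, [/\ forall p, owner p \notin R p, forall p, #|R p| = k,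
    forall i, load R i <= A, forall p, owner p \notin W -> R p = R0 p &
    forall p, owner p = l -> (R0 p :&: W \subset R p) && (R p \subset R0 p :|: W)].
Proof.
move=> cW lW own0 card0 full0 load0.
pose L p := if owner p \notin W then R0 p else
            if owner p == l then R0 p :&: W else set0.
pose H p := if owner p \notin W then R0 p else
            if owner p == l then (R0 p :|: W) :\ l else ~: [set owner p].
have b0 : between L H R0.
  move=> p; rewrite /L /H; case: ifP => _; first by rewrite !subxx.
  case: eqP => [pl|_]; last by rewrite sub0set subsetC sub1set inE own0.
  by rewrite subsetIl subsetD1 subsetUl -pl own0.
have le0 i : load R0 i <= A.
  rewrite load0; apply: leq_trans (papers_le i); rewrite -sum_nat_const.
  exact: leq_sum.
have [R [T [[bR cR lR] [full closedT stuck]]]] := augment_to_cut b0 card0 le0.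
have ownH p : owner p \notin H p.
  rewrite /H; case: ifP => // _; case: eqP => [->|_]; by rewrite !inE eqxx.
exists R; split.
- by move=> p; apply: contra (ownH p); have /andP[_ /subsetP] := bR p; apply.
- move=> j; apply/eqP; rewrite eqn_leq; have /andP[le0j ->] := cR j.
  rewrite leqNgt; apply/negP => ltj.
  set V := W :\ l; have lV : l \notin V by rewrite !inE eqxx.
  have WE : W = l |: V by rewrite setD1K.
  have cV : #|V| = k by move: cW; rewrite WE cardsU1 lV => -[].
  have jV : owner j \in V.
    by apply: contraLR ltj => /full0 <-; rewrite -leqNgt.
  have HV p : owner p \in V -> H p = ~: [set owner p].
    by rewrite !inE /H => /andP[/negPf -> ->].
  have LV p : owner p \in V -> L p = set0.
    by rewrite !inE /L => /andP[/negPf -> ->].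
  have cT : #|T| <= k.
    apply: leq_trans (ltj); rewrite -[#|R j|.+1]add1n -(cards1 (owner j)).
    apply: leq_trans (leq_card_setU _ _); apply: subset_leq_card.
    apply/subsetP => t tT; rewrite !inE.
    by case: (eqVneq t (owner j)) => //= tj; apply: (stuck j t ltj tT); rewrite HV // !inE.
  have TV p t : owner p \in V -> t \in T -> t != owner p -> t \in R p.
    move=> pV tT tp; have tH : t \in H p by rewrite HV // !inE.
    have [ltp|gep] := ltnP #|R p| k; first exact: stuck ltp tT tH.
    apply/negPn/negP => tR.
    have RT : R p \subset T.
      by apply/subsetP => y yR; apply: (closedT t p) => //; rewrite !inE ?tR ?tH ?yR // LV // inE.
    have /eqP RTE : R p == T by rewrite eqEcard RT (leq_trans cT gep).
    by rewrite RTE tT in tR.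
  have Tl p : owner p = l -> k <= #|R p :&: T| + #|V :\: T|.
    move=> pl; have cp : #|R p| = k.
      have := cR p; rewrite (full0 p) ?pl // => le_le; lia.
    have [sub|/subsetPn[t]] := boolP (V :&: T \subset R p).
      rewrite -cV -(cardsID T V) leq_add2r; apply: subset_leq_card.
      by rewrite subsetI sub subsetIr.
    rewrite inE => /andP[tV tT] tR.
    rewrite -cp -(cardsID T (R p)) leq_add2l; apply: subset_leq_card.
    apply/subsetP => y; rewrite !inE => /andP[yT yR]; rewrite yT /=.
    have yH : y \in H p by have /andP[_ /subsetP] := bR p; apply.
    have yl : y != l by apply: contraTneq yH => ->; rewrite -pl ownH.
    rewrite yl /=; apply: contraR yT => yW.
    apply: (closedT t p) => //; rewrite !inE ?tR ?yR /H /L pl lW eqxx /=.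
      by move: tV; rewrite !inE => /andP[-> ->]; rewrite orbT.
    by rewrite inE (negPf yW) andbF.
  have := cut_load cV lV cT (fun i => proj2 (andP (lR i))) full TV Tl.
  rewrite -WE => loadW.
  have loadC : k * #|papers (~: W)| <= \sum_(i in ~: W) load R i.
    rewrite card_papers big_distrr /=; apply: leq_sum => i; rewrite inE => iW.
    have /andP[le_i _] := lR i; apply: leq_trans le_i; rewrite load0 mulnC -sum_nat_const.
    apply: leq_sum => p; rewrite !inE => /eqP pi; rewrite full0 // pi.
    by rewrite !inE (negPf iW) andbF.
  have tot : \sum_p #|R p| < k * #|P|.
    rewrite mulnC -sum_nat_const (bigD1 j) //= [X in _ < X](bigD1 j) //= -addSn.
    by apply: leq_add => //; apply: leq_sum => p _; have /andP[] := cR p.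
  move: tot; rewrite -sum_load (bigID (mem W)) /= ltnNge; case/negP.
  rewrite -[#|P|]cardsT (_ : setT = papers (W :|: ~: W)); last first.
    by rewrite setUCr; apply/setP => p; rewrite !inE.
  rewrite card_papersU ?mulnDr; last by rewrite -setI_eq0 setICr.
  apply: leq_add => //; apply: leq_trans loadC _.
  by rewrite (eq_bigl (fun i => i \notin W)) // => i; rewrite inE.
- by move=> i; have /andP[] := lR i.
- move=> p pW; have := bR p; rewrite /L /H pW => /andP[s1 s2].
  by apply/eqP; rewrite eqEsubset s1 s2.
- move=> p pl; have := bR p; rewrite /L /H pl lW eqxx /= => /andP[-> s].
  exact: subset_trans s (subsetDl _ _).
Qed.

End Filling.

Lemma functional_cycle (I : finType) (f : I -> I) (U : {set I}) :
  U != set0 -> {in U, forall i, f i \in U} ->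
  exists2 Y : {set I}, (Y != set0) && (Y \subset U)
    & f @: Y = Y /\ {in Y &, injective f}.
Proof.
move=> U0 fU.
pose stable (Y : {set I}) := [&& Y != set0, Y \subset U & f @: Y \subset Y].
have stU : stable U.
  by rewrite /stable U0 subxx; apply/subsetP => _ /imsetP[i iU ->]; apply: fU.
case: (arg_minnP (fun Y : {set I} => #|Y|) stU) => Y /and3P[Y0 YU fY] minY.
have fY0 : f @: Y != set0.
  by case/set0Pn: Y0 => y yY; apply/set0Pn; exists (f y); apply: imset_f.
have st_fY : stable (f @: Y) by rewrite /stable fY0 (subset_trans fY YU) imsetS.
have /eqP fYE : f @: Y == Y by rewrite eqEcard fY minY.
by exists Y; [rewrite Y0|split=> //; apply/imset_injP; rewrite fYE].
Qed.

Lemma set_between_card (I : finType) (A B : {set I}) m :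
  A \subset B -> #|A| <= m <= #|B| ->
  exists W : {set I}, [/\ A \subset W, W \subset B & #|W| = m].
Proof.
have [d] := ubnP (m - #|A|); elim: d A => // d IH A led AB /andP[Am mB].
have [ltm|gem] := ltnP #|A| m; last by exists A; split=> //; lia.
have /properP[_ [x xB xA]] : A \proper B by rewrite properEcard AB (leq_trans ltm).
have cx : #|x |: A| = #|A|.+1 by rewrite cardsU1 xA.
case: (IH (x |: A)); rewrite ?cx ?ltm ?mB ?subUset ?sub1set ?xB //; first by lia.
by move=> W []; rewrite subUset => /andP[_ AW] WB cW; exists W.
Qed.

Section TopTradingCycles.
Variables (I P : finType) (owner : P -> I) (k : nat) (sigma : P -> I -> nat).
Hypothesis sigma_inj : forall p, {in ~: [set owner p] &, injective (sigma p)}.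
Implicit Types (R : P -> {set I}) (A S : {set I}) (i : I) (p : P).

Definition top_choice p A S :=
  forall a b, a \in A -> b \in S -> b != owner p -> b \notin A ->
    sigma p a < sigma p b.

Lemma top_choiceS p A S S' : S \subset S' -> top_choice p A S' -> top_choice p A S.
Proof. by move=> /subsetP SS' top a b aA /SS'; apply: top. Qed.

Definition unmet R := [set i | [exists p, (owner p == i) && (#|R p| < k)]].

Lemma unmetS R R' : (forall p, R p \subset R' p) -> unmet R' \subset unmet R.
Proof.
move=> sRR'; apply/subsetP => i; rewrite !inE => /existsP[p /andP[pi ltp]].
by apply/existsP; exists p; rewrite pi (leq_ltn_trans (subset_leq_card (sRR' p))).
Qed.

Lemma card_met R p : #|R p| <= k -> owner p \notin unmet R -> #|R p| = k.
Proof.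
move=> leR; rewrite inE => /existsPn/(_ p); rewrite eqxx -leqNgt => geR.
by apply/eqP; rewrite eqn_leq leR.
Qed.

Definition trading_state R :=
  [/\ forall p, owner p \notin R p, forall p, #|R p| <= k,
      forall i, load R i = \sum_(p in papers owner [set i]) #|R p|,
      forall p, owner p \in unmet R -> top_choice p (R p) (unmet R)
    & forall S, ~~ (S \subset unmet R) -> exists2 i, i \in S :\: unmet R &
        forall p, owner p = i -> top_choice p (R p) S].

Definition request R i (x : P * I) :=
  [/\ owner x.1 = i, #|R x.1| < k, x.2 \in unmet R :\: R x.1, x.2 != i &
      forall c, c \in unmet R -> c != i -> c \notin R x.1 ->
        sigma x.1 x.2 <= sigma x.1 c].

Lemma request_exists R i : (forall p, owner p \notin R p) ->
  k < #|unmet R| -> i \in unmet R -> exists x, request R i x.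
Proof.
move=> ownR ltU iU; have := iU; rewrite inE => /existsP[p /andP[/eqP pi ltp]].
pose ok b := (b \in unmet R) && (b != i) && (b \notin R p).
have /subsetPn[b0 b0U b0R] : ~~ (unmet R \subset i |: R p).
  apply: contraL ltU => /subset_leq_card le_U; rewrite -leqNgt.
  by apply: leq_trans le_U _; rewrite cardsU1 -pi ownR add1n.
have ok0 : ok b0 by move: b0R; rewrite /ok b0U !inE negb_or.
case: (arg_minnP (sigma p) ok0) => b /andP[/andP[bU bi] bR] minb.
exists (p, b); split=> //=; first by rewrite inE bR.
by move=> c cU ci cR; apply: minb; rewrite /ok cU ci.
Qed.

Lemma trading_step R : trading_state R -> k < #|unmet R| ->
  exists R', [/\ forall p, R p \subset R' p, \sum_p #|R p| < \sum_p #|R' p|,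
    trading_state R' & forall p, owner p \in unmet R -> top_choice p (R' p) (unmet R)].
Proof.
move=> [ownR cardR loadR topR doneR] ltU; set U := unmet R.
have [h hP] : exists h : I -> P * I, forall i, i \in U -> request R i (h i).
  apply: (@fin_all_exists _ _ (fun i x => i \in U -> request R i x)) => i.
  have [iU|_] := boolP (i \in U).
    by have [x xP] := request_exists ownR ltU iU; exists x.
  have /card_gt0P[u uU] : 0 < #|U| by apply: leq_ltn_trans ltU.
  by have [x _] := request_exists ownR ltU uU; exists x.
pose pp i := (h i).1; pose nx i := (h i).2.
have U0 : U != set0 by rewrite -card_gt0 (leq_ltn_trans _ ltU).
have nxU : {in U, forall i, nx i \in U}.
  by move=> i /hP[_ _]; rewrite inE => /andP[].
have [Y /andP[Y0 /subsetP YU] [nxY nx_inj]] := functional_cycle U0 nxU.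
have ppE i : i \in Y -> owner (pp i) = i by case/YU/hP.
have nxR i : i \in Y -> nx i \notin R (pp i).
  by case/YU/hP=> _ _; rewrite inE => /andP[].
pose R' p := if (owner p \in Y) && (p == pp (owner p)) then nx (owner p) |: R p else R p.
have R'pp i : i \in Y -> R' (pp i) = nx i |: R (pp i).
  by move=> iY; rewrite /R' ppE // iY eqxx.
have R'id p : p != pp (owner p) -> R' p = R p by rewrite /R' => /negPf ->; rewrite andbF.
have R'out p : owner p \notin Y -> R' p = R p by rewrite /R' => /negPf ->.
have R'P p : R' p = R p \/ exists2 i, i \in Y & p = pp i.
  have [pY|/R'out] := boolP (owner p \in Y); last by left.
  by have [->|/R'id] := eqVneq p (pp (owner p)); [right; exists (owner p)|left].
have sRR' p : R p \subset R' p.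
  by rewrite /R'; case: ifP => // _; apply: subsetUr.
have sU := unmetS sRR'.
have card' i : i \in Y -> #|R' (pp i)| = #|R (pp i)|.+1.
  by move=> iY; rewrite R'pp // cardsU1 nxR.
have topU p : owner p \in U -> top_choice p (R' p) U.
  move=> pU; case: (R'P p) => [->|[i iY pE]]; first exact: topR.
  rewrite {}pE in pU *; rewrite R'pp // => a b a_in bU; rewrite ppE // => bi.
  rewrite in_setU1 negb_or => /andP[b_nx bR].
  case/setU1P: a_in => [->|aR]; last by apply: (topR (pp i)) => //; rewrite ppE.
  have [_ _ _ nxi min_nx] := hP i (YU i iY).
  rewrite ltn_neqAle min_nx // andbT; apply: contra b_nx => /eqP eq_s.
  by apply/eqP/esym; apply: sigma_inj eq_s; rewrite !inE ppE.
exists R'; split=> //.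
  case/set0Pn: Y0 => y yY; rewrite (bigD1 (pp y)) //= [X in _ < X](bigD1 (pp y)) //=.
  rewrite card' // addSn ltnS leq_add2l; apply: leq_sum => p _.
  exact: subset_leq_card.
split.
- move=> p; case: (R'P p) => [-> //|[i iY ->]]; rewrite R'pp // !inE negb_or ownR.
  by rewrite andbT ppE // eq_sym; case/YU/hP: iY.
- move=> p; case: (R'P p) => [-> //|[i iY ->]]; rewrite card' //.
  by case/YU/hP: iY.
- move=> i.
  have -> : load R' i = load R i + (i \in Y).
    have [iY|iY] := boolP (i \in Y).
      have := iY; rewrite -{1}nxY => /imsetP[y yY iE].
      rewrite /load addn1 (_ : [set p | _] = pp y |: [set p | i \in R p]).
        by rewrite cardsU1 !inE iE nxR.
      apply/setP => p; rewrite !inE.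
      case: (R'P p) => [E|[z zY ->]].
        rewrite E; case: (eqVneq p (pp y)) => // py.
        by rewrite -E py R'pp // iE !inE eqxx.
      rewrite R'pp // !inE; congr (_ || _).
      apply/eqP/eqP => [iz|/(congr1 owner)]; last by rewrite !ppE // => ->.
      by congr pp; apply: nx_inj; rewrite // -iE.
    rewrite addn0 /load; congr #|pred_of_set _|; apply/setP => p; rewrite !inE.
    case: (R'P p) => [-> //|[z zY ->]]; rewrite R'pp // !inE.
    by rewrite (_ : i == nx z = false) //; apply: contraNF iY => /eqP ->; rewrite -nxY imset_f.
  rewrite loadR; have [iY|iY] := boolP (i \in Y); last first.
    rewrite addn0; apply: eq_bigr => p; rewrite !inE => /eqP pi.
    by rewrite R'out // pi.
  have pi : pp i \in papers owner [set i] by rewrite !inE ppE.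
  rewrite (bigD1 (pp i)) //= [RHS](bigD1 (pp i)) //= card' // addn1 addSn.
  congr (_ + _).+1; apply: eq_bigr => p; rewrite !inE => /andP[/eqP pi' ppi].
  by rewrite R'id // pi'.
- by move=> p /(subsetP sU)/topU; apply: top_choiceS.
- move=> S SU'; have [SU|/doneR[i]] := boolP (S \subset U).
    case/subsetPn: SU' => i iS iU'; exists i; first by rewrite inE iU'.
    by move=> p pi; apply: (top_choiceS SU); apply: topU; rewrite pi (subsetP SU).
  rewrite inE => /andP[iU iS] topi; exists i.
    by rewrite inE iS andbT; apply: contra iU; apply: (subsetP sU).
  move=> p pi; rewrite R'out; first exact: topi.
  by rewrite pi; apply: contra iU => /YU.
Qed.

Lemma trading_outcome : (forall i, exists p, owner p = i) -> 0 < k -> k < #|I| ->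
  exists R (W : {set I}) l,
    [/\ #|W| = k.+1, l \in W, forall p, owner p \notin R p, forall p, #|R p| <= k
      & forall p, owner p \notin W :\ l -> #|R p| = k] /\
    [/\ forall i, load R i = \sum_(p in papers owner [set i]) #|R p|,
        forall S, ~~ (S \subset W) -> exists2 i, i \in S :\: W &
          forall p, owner p = i -> top_choice p (R p) S
      & forall p, owner p = l -> top_choice p (R p) W].
Proof.
move=> has_paper k_gt0 ltk.
pose R0 (p : P) : {set I} := set0.
have U0 : unmet R0 = setT.
  apply/setP => i; rewrite !inE; have [p pi] := has_paper i.
  by apply/existsP; exists p; rewrite pi eqxx cards0.
have st0 : trading_state R0.
  split=> [p|p|i|p _ a b|S].
  - by rewrite inE.
  - by rewrite cards0.
  - rewrite big1 => [|p _]; last by rewrite cards0.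
    by apply/eqP; rewrite cards_eq0; apply/eqP/setP => p; rewrite !inE.
  - by rewrite inE.
  - by rewrite U0 subsetT.
have: k < #|unmet R0| by rewrite U0 cardsT.
move: R0 st0 {U0} => R0.
have [N] := ubnP (\sum_p (k - #|R0 p|)); elim: N R0 => // N IH R leN stR ltU.
have [R' [sRR' ltS stR' topU]] := trading_step stR ltU.
have [own' card' load' _ done'] := stR'.
have [ltU'|leU'] := ltnP k #|unmet R'|.
  apply: IH stR' ltU'; rewrite -(ltn_add2r (\sum_p #|R' p|)) -big_split /=.
  under eq_bigr do rewrite subnK //.
  have [_ cardR _ _ _] := stR.
  have E : \sum_p (k - #|R p|) + \sum_p #|R p| = \sum_(p : P) k.
    by rewrite -big_split /=; apply: eq_bigr => p _; rewrite subnK.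
  by rewrite -E; move: leN ltS; clear; lia.
have sU := unmetS sRR'.
have [|W [UW WU cW]] := @set_between_card _ _ _ k.+1 sU; first by rewrite ltU leqW.
have /subsetPn[l lW lU] : ~~ (W \subset unmet R').
  by apply: contraL leU' => /subset_leq_card; rewrite cW -ltnNge.
exists R', W, l; split; split=> //.
- move=> p pWl; apply: card_met => //; apply: contra pWl => pU.
  by rewrite !inE (subsetP UW) // andbT; apply: contraNneq lU => <-.
- move=> S SW; have [SU|] := boolP (S \subset unmet R).
    case/subsetPn: SW => i iS iW; exists i; first by rewrite inE iW.
    by move=> p pi; apply: (top_choiceS SU); apply: topU; rewrite pi (subsetP SU).
  have [_ _ _ _ /(_ S) doneR SU] := stR.
  have [i] := doneR SU; rewrite inE => /andP[iU iS] topi; exists i.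
    by rewrite inE iS andbT; apply: contra iU; apply: (subsetP WU).
  move=> p pi; rewrite (_ : R' p = R p); first exact: topi.
  apply/esym/eqP; rewrite eqEcard sRR' (@card_met R) ?card' ?pi //.
  by have [_ ->] := stR.
- by move=> p pl; apply: (top_choiceS WU); apply: topU; rewrite pl (subsetP WU).
Qed.
End TopTradingCycles.

Lemma order_separable_weak n (P : finType) (owner : P -> 'I_n) sigma pe p
    (S1 S2 : {set 'I_n}) :
  paper_ext owner pe -> order_separable owner sigma pe ->
  owner p \notin S1 -> owner p \notin S2 -> #|S1| = #|S2| ->
  (forall a b, a \in S1 :\: S2 -> b \in S2 :\: S1 -> sigma p a < sigma p b) ->
  pe p S1 S2.
Proof.
move=> ext sep o1 o2 cS lt12.
have sub (S : {set 'I_n}) : owner p \notin S -> S \subset ~: [set owner p].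
  by move=> oS; rewrite subsetC sub1set inE.
have [D0|D0] := eqVneq (S1 :\: S2) set0.
  have /eqP -> : S1 == S2 by rewrite eqEcard cS leqnn andbT -setD_eq0 D0.
  by have [tot _] := ext p; case: (tot S2 S2) => //; apply: sub.
have [] := sep p (S1 :\: S2) (S2 :\: S1) (S1 :&: S2); rewrite ?card_gt0 //.
- by apply: sub; rewrite inE (negPf o1) andbF.
- by apply: sub; rewrite inE (negPf o2) andbF.
- by apply: sub; rewrite inE (negPf o1).
- by rewrite -setI_eq0; apply/eqP/setP => x; rewrite !inE; do 2!case: (x \in _).
- by rewrite -setI_eq0; apply/eqP/setP => x; rewrite !inE; do 2!case: (x \in _).
- by rewrite -setI_eq0; apply/eqP/setP => x; rewrite !inE; do 2!case: (x \in _).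
- by have := cardsID S2 S1; have := cardsID S1 S2; rewrite setIC cS; lia.
by rewrite setUC setID [S1 :&: S2]setIC setUC setID.
Qed.

Theorem mainTheorem1 (n ka kp : nat) (P : finType) (owner : P -> 'I_n)
    (sigma : P -> 'I_n -> nat) :
  0 < ka -> 0 < kp -> kp.+1 <= n ->
  (forall i : 'I_n, exists p, owner p = i) ->
  (forall i : 'I_n, #|[set p | owner p == i]| * kp <= ka) ->
  (forall p, {in ~: [set owner p] &, injective (sigma p)}) ->
  exists R : {ffun 'I_n * P -> bool},
    valid ka kp owner R /\
    forall (pe : P -> {set 'I_n} -> {set 'I_n} -> Prop)
           (ae : 'I_n -> asg n P -> asg n P -> Prop),
      paper_ext owner pe -> agent_ext ka kp owner ae ->
      order_separable owner sigma pe -> consistent ka kp owner pe ae ->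
      in_core ka kp owner ae R.
Proof.
move=> _ kp_gt0 ltn has_paper papers_le sigma_inj.
have papers_le' i : #|papers owner [set i]| * kp <= ka.
  apply: leq_trans (papers_le i); rewrite (_ : papers _ _ = [set p | owner p == i]) //.
  by apply/setP => p; rewrite !inE.
have ltI : kp < #|'I_n| by rewrite card_ord.
have [R0 [W [l [[cW lW own0 card0 full0] [load0 topS topl]]]]] :=
  trading_outcome sigma_inj has_paper kp_gt0 ltI.
have [R [ownR cardR loadR fixR lR]] :=
  fill_gaps kp_gt0 papers_le' cW lW own0 card0 full0 load0.
pose F := [ffun ip : 'I_n * P => ip.1 \in R ip.2].
have revF p : reviewers (full F) p = R p.
  by apply/setP => i; rewrite !inE ffunE.
have validF : valid ka kp owner F.
  split=> [i j _|j _|i _|j _|i j _ _ <-]; rewrite ?inE //.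
  - rewrite (_ : rev_load _ i = [set p | i \in R p]); first exact: loadR.
    by apply/setP => p; rewrite !inE ffunE.
  - by rewrite revF.
  - by rewrite /full /asg_map /= ffunE; apply/negbTE/ownR.
exists F; split=> // pe ae ext _ sep cons; split=> //.
case=> -[[N' P'] Rh]; set a := (N', P', Rh) => -[N0 [va block]].
have [_ ownN _ cardh ownh] := va.
have noh p : p \in P' -> owner p \notin reviewers a p.
  by move=> pP; rewrite inE; apply/andP => -[oN]; rewrite (ownh _ p oN pP).
have subh p : reviewers a p \subset N'.
  by apply/subsetP => i; rewrite inE => /andP[].
have no_good i : i \in N' ->
    ~ (forall p, p \in P' -> owner p = i -> pe p (R p) (reviewers a p)).
  move=> iN good; have [_ []] := block i iN; apply: cons => // p pP pi.
  by rewrite revF; apply: good.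
have [NW|/topS[i]] := boolP (N' \subset W); last first.
  rewrite inE => /andP[iW iN] top; apply: (no_good i iN) => p pP pi.
  apply: (order_separable_weak ext sep); rewrite ?noh ?ownR ?cardR ?cardh //.
  move=> x y; rewrite fixR ?pi // !(inE, in_setD) => /andP[_ xR] /andP[yR yh].
  apply: (top p) => //; first by rewrite (subsetP (subh p)) // inE.
  by apply: contraNneq (noh p pP) => <-; rewrite inE.
have WN : N' = W.
  apply/eqP; rewrite eqEcard NW cW /=.
  have [i iN] := set0Pn _ N0.
  have [/exists_inP[p pP /eqP pi]|/exists_inPn no_p] :=
      boolP [exists p in P', owner p == i].
    rewrite -(cardh p pP).
    have := cardsU1 (owner p) (reviewers a p); rewrite noh // add1n => <-.
    by apply: subset_leq_card; rewrite subUset sub1set subh pi iN.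
  by case: (no_good i iN) => p /no_p/eqP.
have lN : l \in N' by rewrite WN.
apply: (no_good l lN) => p pP pl; have /andP[keep new] := lR p pl.
have hE : reviewers a p = W :\ l.
  apply/eqP; rewrite eqEcard cardh //; apply/andP; split.
    by rewrite subsetD1 -WN subh -pl noh.
  by move: cW; rewrite (cardsD1 l) lW add1n => -[->].
apply: (order_separable_weak ext sep); rewrite ?noh ?ownR ?cardR ?cardh //.
rewrite hE => x y; rewrite !inE negb_and negbK => /andP[xW xR] /andP[yR /andP[yl yW]].
have xW' : x \notin W.
  by case/orP: xW => // /eqP xl; rewrite -pl in xl; rewrite xl (negPf (ownR p)) in xR.
apply: (topl p) => //; rewrite ?pl //.
  by have := subsetP new x xR; rewrite inE (negPf xW') orbF.
by apply: contra yR => y0; apply: (subsetP keep); rewrite inE y0.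
Qed.
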